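(* Suppose that $u_h=u_h(\cdot,t)\in V_h$ satisfies the semi-discrete continuous Galerkin scheme $$\sum_{e=1}^{E_h}\int_{K^e} w_h\left(\frac{\partial u_h}{\partial t}+\nabla\cdot \mathbf{f}(u_h)\right)\,\mathrm{d}\mathbf{x}=0\qquad \forall w_h\in V_h .$$ Then, for the square entropy $\eta(u)=\frac{u^2}{2}$ and a corresponding entropy flux $\mathbf{q}$ (i.e. $\mathbf{q}'(u)=u\,\mathbf{f}'(u)$), $$\sum_{e=1}^{E_h}\int_{K^e}\left(\frac{\partial \eta(u_h)}{\partial t}+\nabla\cdot\mathbf{q}(u_h)\right)\mathrm{d}\mathbf{x}=0 .$$
   Context: The scalar conservation law is $\frac{\partial u}{\partial t}+\nabla\cdot\mathbf{f}(u)=0$ in $\mathbb{R}^d\times\mathbb{R}_+$, $d\in\{1,2,3\}$, with a possibly nonlinear, differentiable flux function $\mathbf{f}=(\mathsf{f}_1,\ldots,\mathsf{f}_d)$. Let $\mathcal G\subset\mathbb{R}$ be a convex set (an invariant set of the initial value problem). A convex function $\eta:\mathcal G\to\mathbb{R}$ is called an entropy, and $v(u)=\eta'(u)$ the entropy variable, if there is an entropy flux $\mathbf{q}:\mathcal G\to\mathbb{R}^d$ with $v(u)\mathbf{f}'(u)=\mathbf{q}'(u)$. The function $u_h$ takes values in $\mathcal G$. Discretization: $\mathcal T_h=\{K^1,\ldots,K^{E_h}\}$ is a conforming mesh of a bounded domain in $\mathbb{R}^d$, with $\bar\Omega_h=\bigcup_{e=1}^{E_h}K^e$; periodic boundary conditions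 are assumed. For $p\in\mathbb{N}$, $V_h^e\in\{\mathbb{P}_p(K^e),\mathbb{Q}_p(K^e)\}$ is the local polynomial space on $K^e$, and $V_h=\{v_h\in C(\bar\Omega_h): v_h|_{K^e}\in V_h^e,\ e=1,\ldots,E_h\}$ is the space of continuous piecewise-polynomial functions. The function $u_h(\cdot,t)\in V_h$ is differentiable in time, and all statements are for each fixed $t$. *)

(* Defs.v *)
From HB Require Import structures.
From mathcomp Require Import all_boot all_order all_algebra.
From mathcomp Require Import all_classical all_reals all_analysis.

Set Implicit Arguments.
Unset Strict Implicit.
Unset Printing Implicit Defensive.

Import Order.TTheory GRing.Theory Num.Theory.
Import numFieldNormedType.Exports.

Local Open Scope classical_set_scope.
Local Open Scope ring_scope.

Section lebesgue_rV.
Context {R : realType}.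

Let coor n : 'I_n -> 'rV[R]_n -> R := fun i x => x ord0 i.

Let rV_set0 n : g_sigma_preimage (@coor n) set0.
Proof. exact: sigma_algebra0. Qed.

Let rV_setC n A : g_sigma_preimage (@coor n) A ->
  g_sigma_preimage (@coor n) (~` A).
Proof. exact: sigma_algebraC. Qed.

Let rV_bigcup n (F : (set _)^nat) :
  (forall i, g_sigma_preimage (@coor n) (F i)) ->
  g_sigma_preimage (@coor n) (\bigcup_i F i).
Proof. exact: sigma_algebra_bigcup. Qed.

HB.instance Definition _ n := @isMeasurable.Build default_measure_display
  'rV[R]_n (g_sigma_preimage (@coor n)) (@rV_set0 n) (@rV_setC n)
  (@rV_bigcup n).

Lemma measurable_coor n i : measurable_fun setT (@coor n i).
Proof.
move=> _ Y mY; rewrite setTI; apply: sub_sigma_algebra => /=.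
rewrite -bigcup_seq/=; exists i => /=; first by rewrite mem_index_enum.
by exists Y => //; rewrite setTI.
Qed.

Definition cons_rV n (x : R * 'rV[R]_n) : 'rV[R]_n.+1 := row_mx x.1%:M x.2.

Lemma measurable_cons_rV n : measurable_fun setT (@cons_rV n).
Proof.
suff h : g_sigma_preimage (fun i => @coor n.+1 i \o @cons_rV n) `<=` measurable.
  move=> _ A mA; apply: h; rewrite g_sigma_preimage_comp.
  by exists A.
apply: smallest_sub; first exact: sigma_algebra_measurable.
rewrite -bigcup_mkord_ord; apply: bigcup_sub => i Ii B [C mC <-].
suff : measurable_fun setT (@coor n.+1 (inord i) \o @cons_rV n) by apply.
have [j|j] := fintype.splitP (inord i : 'I_(1 + n)) => /= ij.
  rewrite (_ : _ \o _ = fst); first exact: measurable_fst.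
  apply/funext => x /=; rewrite /coor /cons_rV.
  have -> : inord i = lshift n j :> 'I_(1 + n) by apply/val_inj.
  by rewrite (@row_mxEl _ 1 1 n) !ord1 mxE eqxx.
rewrite (_ : _ \o _ = @coor n j \o snd).
  by apply: measurableT_comp; [exact: measurable_coor|exact: measurable_snd].
apply/funext => x /=; rewrite /coor /cons_rV.
have -> : inord i = rshift 1 j :> 'I_(1 + n) by apply/val_inj.
by rewrite (@row_mxEr _ 1 1 n).
Qed.

Section lebesgue_rVS.
Local Open Scope ereal_scope.
Context n (m : {sigma_finite_measure set 'rV[R]_n -> \bar R}).

Definition lebesgue_rVS := pushforward (@lebesgue_measure R \x m) (@cons_rV n).

Let mpre A : measurable A -> measurable (@cons_rV n @^-1` A).
Proof.
by move=> mA; rewrite -[X in measurable X]setTI; exact: measurable_cons_rV.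
Qed.

Let lebesgue_rVS0 : lebesgue_rVS set0 = 0.
Proof. by rewrite /lebesgue_rVS /pushforward preimage_set0 measure0. Qed.

Let lebesgue_rVS_ge0 A : 0 <= lebesgue_rVS A.
Proof. rewrite /lebesgue_rVS /pushforward; exact: measure_ge0. Qed.

Let lebesgue_rVS_sigma_additive : semi_sigma_additive lebesgue_rVS.
Proof.
move=> F mF tF mUF; rewrite /lebesgue_rVS /pushforward preimage_bigcup.
apply: measure_semi_sigma_additive.
- by move=> k; exact: mpre.
- apply/trivIsetP => /= i j _ _ ij; rewrite -preimage_setI.
  by move/trivIsetP : tF => /(_ _ _ _ _ ij) ->//; rewrite preimage_set0.
- by rewrite -preimage_bigcup; exact: mpre.
Qed.

HB.instance Definition _ := isMeasure.Build _ _ _ lebesgue_rVS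
  lebesgue_rVS0 lebesgue_rVS_ge0 lebesgue_rVS_sigma_additive.

Let lebesgue_rVS_sigma_finite : sigma_finite setT lebesgue_rVS.
Proof.
have /sigma_finiteP[F [TF ndF Foo]] := sigma_finiteT (@lebesgue_measure R).
have /sigma_finiteP[G [TG ndG Goo]] := sigma_finiteT m.
pose hd (x : 'rV[R]_n.+1) : R := x ord0 ord0.
pose tl (x : 'rV[R]_n.+1) : 'rV[R]_n := @rsubmx _ 1 1 n x.
have hdK x y : hd (cons_rV (x, y)) = x.
  rewrite /hd /cons_rV /=.
  have -> : ord0 = lshift n (ord0 : 'I_1) :> 'I_(1 + n) by apply/val_inj.
  by rewrite (@row_mxEl _ 1 1 n) mxE eqxx.
have tlK x y : tl (cons_rV (x, y)) = y by rewrite /tl /cons_rV row_mxKr.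
have mhd : measurable_fun setT hd by exact: measurable_coor.
have mtl : measurable_fun setT tl.
  suff h : g_sigma_preimage (fun i => @coor n i \o tl) `<=` measurable.
    move=> _ A mA; apply: h; rewrite g_sigma_preimage_comp.
    by exists A.
  apply: smallest_sub; first exact: sigma_algebra_measurable.
  rewrite -bigcup_seq; apply: bigcup_sub => i Ii B [C mC <-].
  suff -> : @coor n i \o tl = @coor n.+1 (rshift 1 i : 'I_(1 + n)).
    exact: measurable_coor.
  by apply/funext => x; rewrite /coor /tl /= mxE.
exists (fun k => hd @^-1` F k `&` tl @^-1` G k).
  apply/esym; rewrite -subTset => x _.
  have : setT (hd x) by []. rewrite TF => -[k _ Fk].
  have : setT (tl x) by []. rewrite TG => -[l _ Gl].
  exists (maxn k l) => //; split => /=.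
  - by move: (hd x) Fk; exact/subsetPset/ndF/leq_maxl.
  - by move: (tl x) Gl; exact/subsetPset/ndG/leq_maxr.
move=> k; have [mF ?] := Foo k; have [mG ?] := Goo k; split.
  apply: measurableI; rewrite -[X in measurable X]setTI; first exact: mhd.
  exact: mtl.
rewrite /lebesgue_rVS /pushforward.
have -> : @cons_rV n @^-1` (hd @^-1` F k `&` tl @^-1` G k) = F k `*` G k.
  apply/seteqP; split=> -[x y]/=; by rewrite !hdK !tlK.
by rewrite product_measure1E// lte_mul_pinfty// ge0_fin_numE.
Qed.

HB.instance Definition _ := Measure_isSigmaFinite.Build _ _ _ lebesgue_rVS
  lebesgue_rVS_sigma_finite.

End lebesgue_rVS.

Fixpoint lebesgue_rV n : {sigma_finite_measure set 'rV[R]_n -> \bar R} :=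
  if n is k.+1 then lebesgue_rVS (lebesgue_rV k) else \d_(0 : 'rV[R]_0).

Lemma measurable_box n (A : 'I_n -> set R) :
  (forall i, measurable (A i)) ->
  measurable [set x : 'rV[R]_n | forall i, A i (x ord0 i)].
Proof.
move=> mA.
rewrite [X in measurable X](_ : _ =
  \big[setI/setT]_(i < n) ((fun x : 'rV[R]_n => x ord0 i) @^-1` A i)).
  apply: bigsetI_measurable => i _; rewrite -[X in measurable X]setTI.
  exact: measurable_coor.
apply/seteqP; split=> x; rewrite -bigcap_seq/= => h i.
  by move=> _; exact: h.
by apply: (h i); rewrite /= mem_index_enum.
Qed.

Lemma lebesgue_rV_box n (A : 'I_n -> set R) :
  (forall i, measurable (A i)) ->
  lebesgue_rV n [set x : 'rV[R]_n | forall i, A i (x ord0 i)] =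
  (\prod_(i < n) lebesgue_measure (A i))%E.
Proof.
elim: n A => [|n IH] A mA.
  rewrite big_ord0 /= diracE mem_set//= => -[].
  by case.
rewrite big_ord_recl/= /lebesgue_rVS /pushforward.
rewrite -(IH (fun i => A (lift ord0 i)))//.
have mB := @measurable_box n (fun i => A (lift ord0 i)) (fun i => mA _).
rewrite -(product_measure1E (@lebesgue_measure R) (lebesgue_rV n) (mA ord0) mB).
congr (product_measure1 _ _ _).
have hd x (y : 'rV[R]_n) : @cons_rV n (x, y) ord0 ord0 = x.
  rewrite /cons_rV /=.
  have -> : ord0 = lshift n (ord0 : 'I_1) :> 'I_(1 + n) by apply/val_inj.
  by rewrite (@row_mxEl _ 1 1 n) mxE eqxx.
have tl x (y : 'rV[R]_n) i : @cons_rV n (x, y) ord0 (lift ord0 i) = y ord0 i.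
  rewrite /cons_rV /=.
  have -> : lift ord0 i = rshift 1 i :> 'I_(1 + n) by apply/val_inj.
  by rewrite (@row_mxEr _ 1 1 n).
apply/seteqP; split=> -[x y]/= => [h|[h1 h2] i].
  split; first by rewrite -(hd x y); exact: h.
  by move=> i; rewrite -(tl x y); exact: h.
by have [j ->|->] := unliftP ord0 i; rewrite ?hd ?tl.
Qed.

End lebesgue_rV.

Section derivative_in.
Context {R : realType} {V : normedModType R}.

(* The derivative relative to A (one-sided at an end point of an interval A):
   the invariant set, on which fluxes and entropies are defined, and the time
   axis are not assumed to be open. *)
Definition derivable_in (A : set R) (g : R -> V) (x : R) :=
  cvg ((w - x)^-1 *: (g w - g x) @[w --> within A x^']).

Definition derive_in (A : set R) (g : R -> V) (x : R) : V :=
  lim ((w - x)^-1 *: (g w - g x) @[w --> within A x^']).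

End derivative_in.

Section mesh.
Context {R : realType}.

Definition convex_hull d k (a : 'I_k -> 'rV[R]_d) : set 'rV[R]_d :=
  [set x | exists c : 'I_k -> R,
    [/\ forall i, 0 <= c i, \sum_i c i = 1 & x = \sum_i c i *: a i]].

Definition polytope d (K : set 'rV[R]_d) :=
  exists k (a : 'I_k -> 'rV[R]_d), K = convex_hull a.

(* For a polytope K these are the vertices, edges, ..., facets of K, together
   with set0 and K. *)
Definition face_of d (F K : set 'rV[R]_d) :=
  [/\ F `<=` K, @convex_set R 'rV[R]_d F &
      forall x y s, K x -> K y -> 0 < s < 1 ->
        F (s *: x + (1 - s) *: y) -> F x /\ F y].

(* The point of the lattice spanned by the rows of L with coordinates z. *)
Definition lattice_point d (L : 'M[R]_d) (z : 'rV[int]_d) : 'rV[R]_d :=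
  map_mx intr z *m L.

Definition translate d (v : 'rV[R]_d) (A : set 'rV[R]_d) : set 'rV[R]_d :=
  [set x + v | x in A].

(* The domain is a cell of the lattice of periods, and conformity is required
   of the periodically extended mesh, so that it includes the matching of
   element faces across the boundary; z = 0 is conformity inside the domain. *)
Record periodic_mesh d := PeriodicMesh {
  domain : set 'rV[R]_d ;
  period : 'M[R]_d ;
  nelem : nat ;
  elem : 'I_nelem -> set 'rV[R]_d ;
  domain_neq0 : domain !=set0 ;
  domain_open : open domain ;
  domain_connected : connected domain ;
  domain_bounded : bounded_set domain ;
  period_unit : period \in unitmx ;
  period_cover : forall x, exists z,
    translate (lattice_point period z) (closure domain) x ;
  elem_polytope : forall e, polytope (elem e) ;
  elem_interior : forall e, (elem e)° !=set0 ;
  elem_cover : closure domain = \bigcup_e elem e ;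
  elem_disjoint : forall e e' z, (e, 0) <> (e', z) ->
    (elem e)° `&` (translate (lattice_point period z) (elem e'))° = set0 ;
  elem_conforming : forall e e' z,
    let K' := translate (lattice_point period z) (elem e') in
    face_of (elem e `&` K') (elem e) /\ face_of (elem e `&` K') K' }.

End mesh.

Section cg_space.
Context {R : realType} {d : nat}.

(* QSpace A: the tensor-product space is taken in the local coordinates
   x *m A of the element, as is usual on parallelepipeds; A = 1%:M gives the
   Cartesian coordinates.  The space of PSpace does not depend on such a
   choice. *)
Variant local_space := PSpace | QSpace (A : 'M[R]_d) of A \in unitmx.

Definition monomial p (a : {ffun 'I_d -> 'I_p.+1}) (x : 'rV[R]_d) : R :=
  \prod_i x ord0 i ^+ a i.

Definition in_local_space p (V : local_space) (K : set 'rV[R]_d)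
    (v : 'rV[R]_d -> R) :=
  match V with
  | PSpace => exists c : {ffun 'I_d -> 'I_p.+1} -> R, forall x, K x ->
      v x = \sum_(a : {ffun 'I_d -> 'I_p.+1} | (\sum_i a i <= p)%N)
               c a * monomial a x
  | QSpace A _ => exists c : {ffun 'I_d -> 'I_p.+1} -> R, forall x, K x ->
      v x = \sum_a c a * monomial a (x *m A)
  end.

(* Functions on the closure of the domain are represented by total functions
   whose values elsewhere are irrelevant.  Periodic boundary conditions are
   imposed on the trial and test functions. *)
Definition cg_space (M : periodic_mesh d) p (V : 'I_(nelem M) -> local_space)
    : set ('rV[R]_d -> R) :=
  [set v | [/\ {within closure (domain M), continuous v},
    forall x z, closure (domain M) x ->
      closure (domain M) (x + lattice_point (period M) z) ->
      v (x + lattice_point (period M) z) = v x &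
    forall e, in_local_space p (V e) (elem e) v]].

End cg_space.
Arguments local_space : clear implicits.

Section conservation_law.
Context {R : realType} {d : nat}.

(* Derivative in time on R_+. *)
Definition dt (w : R -> 'rV[R]_d -> R) (t : R) (x : 'rV[R]_d) : R :=
  derive_in [set s | 0 <= s] (w^~ x) t.

Definition divergence (F : 'rV[R]_d -> 'rV[R]_d) (x : 'rV[R]_d) : R :=
  \sum_i 'D_(delta_mx ord0 i) (fun y => F y ord0 i) x.

(* q' = eta' f' on G *)
Definition entropy_flux (G : set R) (f : R -> 'rV[R]_d) (eta : R -> R)
    (q : R -> 'rV[R]_d) :=
  forall u, G u -> derivable_in G q u /\
    derive_in G q u = derive_in G eta u *: derive_in G f u.

Definition square_entropy (u : R) : R := u ^+ 2 / 2.

(* The gradient of a piecewise polynomial function is only defined inside the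
   elements, whose boundaries are null sets.  The integrals are extended
   real-valued: since oo - oo is -oo, the sum is a real number only if all the
   positive and negative parts have finite integrals. *)
Definition elementwise_integral (M : periodic_mesh d) (g : 'rV[R]_d -> R)
    : \bar R :=
  (\sum_(e < nelem M) \int[lebesgue_rV d]_(x in (elem e)°) (g x)%:E)%E.

Definition cg_scheme (M : periodic_mesh d) p
    (V : 'I_(nelem M) -> local_space R d) (f : R -> 'rV[R]_d)
    (u : R -> 'rV[R]_d -> R) (t : R) :=
  forall w, cg_space p V w ->
    elementwise_integral M
      (fun x => w x * (dt u t x + divergence (f \o u t) x)) = 0%E.

End conservation_law.

(* Main.v *)
Require Import Defs.
From mathcomp Require Import all_boot all_order all_algebra.
From mathcomp Require Import all_classical all_reals all_analysis.
From mathcomp Require Import ring.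
Import Order.TTheory GRing.Theory Num.Theory.
Import numFieldNormedType.Exports.
Local Open Scope classical_set_scope.
Local Open Scope ring_scope.

(** Since the trial functions are themselves test functions, the scheme may be
    tested with [w = u t], and the claim follows once the integrands agree
    at every point of the interior of every element:
    [u * (dt u + div f(u)) = dt (u^2 / 2) + div q(u)].
    This is the chain rule, in time ([dt_square_entropy]) and in space
    ([divergence_entropy_flux]).

    Two points make the chain rule delicate.  The fluxes are differentiable
    only relative to [G], and time only runs over [0, +oo[, so the rule has to
    be stated for relative derivatives; [derivable_in_chain] does this with
    Caratheodory's form of the derivative along an arbitrary filter, which
    covers both uses.  Moreover [G] may be a single point, where relative
    derivatives are not unique and [eta' = u] may fail.  There [u] is constant,
    and in all cases the identity [eta'(u) * D u = u * D u] holds, because both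
    sides are the directional derivative of [eta(u)]
    ([derive_in_square_entropy_chain]).

    Inside an element [u t] is a polynomial, hence differentiable in every
    direction ([derivable_in_local_space]). *)

Set Implicit Arguments.
Unset Strict Implicit.

(** * Chain rules for relative derivatives *)

(** With [psi] the difference quotient of [g] at [c], completed by the value
    [l] at [c], one has [g w - g c = (w - c) *: psi w] for all [w], and [psi] is
    continuous at [c] relative to [A].  Hence [phi] may take the value [c]
    arbitrarily often, and [c] may be isolated in [A].  For [h] the increment
    of a space or time parameter this is the usual chain rule. *)
Lemma derivable_in_chain (R : realType) (V : normedModType R) (A : set R)
    (g : R -> V) (c D : R) (l : V) (T : Type) (F : set_system T)
    (h phi : T -> R) :
  Filter F -> (\forall s \near F, h s != 0) -> h @ F --> 0 ->
  (\forall s \near F, A (phi s)) ->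
  (h s)^-1 * (phi s - c) @[s --> F] --> D ->
  (w - c)^-1 *: (g w - g c) @[w --> within A c^'] --> l ->
  (h s)^-1 *: (g (phi s) - g c) @[s --> F] --> D *: l.
Proof.
move=> FF h_neq0 h_to0 phiA phiD gl.
(* Since h tends to 0, the quotients of phi can only converge if phi tends
   to c. *)
have phic : phi @ F --> c.
  have hk : (fun s => h s * ((h s)^-1 * (phi s - c)) + c) @ F --> c.
    rewrite -[c in X in _ --> X]add0r -(mul0r D).
    by apply: cvgD; [exact: (cvgM h_to0 phiD)|exact: cvg_cst].
  apply: cvg_trans hk; apply: near_eq_cvg.
  by near=> s; rewrite mulrA divff ?mul1r ?subrK//; near: s.
pose psi w := if w == c then l else (w - c)^-1 *: (g w - g c).
have psil : psi (phi s) @[s --> F] --> l.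
  move=> B lB; have /= := gl B lB.
  rewrite /fmap/= !near_simpl => gB.
  have {}gB : \forall w \near c, w != c -> A w -> B ((w - c)^-1 *: (g w - g c)).
    exact: gB.
  have phiB := phic _ gB.
  near=> s; rewrite /psi/=; case: ifPn => [_|phis].
    exact: (nbhs_singleton lB).
  have : phi s != c -> A (phi s) -> B ((phi s - c)^-1 *: (g (phi s) - g c)).
    by near: s; exact: phiB.
  by apply => //; near: s.
apply: cvg_trans (cvgZ phiD psil); apply: near_eq_cvg.
near=> s; rewrite /psi; case: eqP => [->|/eqP phis].
  by rewrite !subrr mulr0 scale0r scaler0.
by rewrite scalerA -mulrA divff ?mulr1// subr_eq0.
Unshelve. all: by end_near. Qed.

(** Valid for every [A]: where [c] is isolated in [A], any vector is a
    relative derivative. *)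
Lemma square_entropy_cvg (R : realType) (A : set R) (c : R) :
  (w - c)^-1 *: (square_entropy w - square_entropy c)
    @[w --> within A c^'] --> c.
Proof.
have : (w + c) / 2 @[w --> within A c^'] --> (c + c) / 2.
  apply: cvgM; last exact: cvg_cst.
  apply: cvgD; last exact: cvg_cst.
  exact: cvg_trans (cvg_within _) (cvg_within _).
have -> : (c + c) / 2 = c by field.
apply: cvg_trans; apply: near_eq_cvg.
rewrite near_withinE; near=> w => _.
have wc : w - c != 0.
  by rewrite subr_eq0; near: w; exact: nbhs_dnbhs_neq.
rewrite /square_entropy /GRing.scale/=.
by field.
Unshelve. all: by end_near. Qed.

(** This makes derivatives in time unique, even at [t = 0]. *)
Lemma within_time_proper (R : realType) (t : R) : 0 <= t ->
  ProperFilter (within [set s | 0 <= s] t^').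
Proof.
move=> t0; apply: Build_ProperFilter_ex => P tP.
have {}tP : \forall s \near t, s != t -> 0 <= s -> P s by exact: tP.
have : \forall s \near t^'+, P s.
  rewrite near_withinE; near=> s => /= ts.
  have : s != t -> 0 <= s -> P s by near: s.
  by apply; [rewrite gt_eqF|rewrite (le_trans t0)// ltW].
by move/filter_ex.
Unshelve. all: by end_near. Qed.

Lemma is_derive_chain_in (R : realType) (W V : normedModType R) (A : set R)
    (g : R -> V) (v : W -> R) (x e : W) (l : V) :
  (\forall y \near x, A (v y)) -> derivable v x e ->
  (w - v x)^-1 *: (g w - g (v x)) @[w --> within A (v x)^'] --> l ->
  is_derive x e (g \o v) ('D_e v x *: l).
Proof.
move=> vA vxe gl.
have quot : h^-1 *: ((g \o v) (h *: e + x) - (g \o v) x) @[h --> 0^']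
    --> 'D_e v x *: l.
  apply: (@derivable_in_chain _ _ A g (v x) _ _ _ _ id
    (fun h => v (h *: e + x))) => //.
  - exact: nbhs_dnbhs_neq.
  - exact: cvg_within.
  - have line : h *: e + x @[h --> (0 : R)^'] --> x.
      rewrite -[x in X in _ --> X]add0r -(scale0r e).
      apply: cvgD; last exact: cvg_cst.
      by apply: cvgZr_tmp; exact: cvg_within.
    exact: (line _ vA).
split; first by apply/cvg_ex; eexists; exact: quot.
exact: (cvg_lim (@norm_hausdorff _ _) quot).
Qed.

(** * Piecewise polynomial functions *)

Lemma derivable_prod (R : realType) (W : normedModType R) (I : finType)
    (F : I -> W -> R) (x e : W) :
  (forall i, derivable (F i) x e) ->
  derivable (fun y => \prod_i F i y) x e.
Proof.
move=> dF; rewrite -fct_prodE.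
elim/big_ind : _ => [|f g|i _]; last exact: dF.
  exact: derivable_cst.
exact: derivableM.
Qed.

Lemma derivable_lincomb (R : realType) (W : normedModType R) (I : finType)
    (P : pred I) (c : I -> R) (F : I -> W -> R) (x e : W) :
  (forall i, derivable (F i) x e) ->
  derivable (fun y => \sum_(i | P i) c i * F i y) x e.
Proof.
move=> dF; rewrite -(fct_sumE _ _ (fun i y => c i * F i y)).
elim/big_ind : _ => [|f1 f2|i _].
- exact: derivable_cst.
- exact: derivableD.
- exact: (derivableM (derivable_cst (c i) x e) (dF i)).
Qed.

Lemma derivable_coord (R : realType) (d : nat) (i : 'I_d) (x e : 'rV[R]_d) :
  derivable (fun y : 'rV[R]_d => y ord0 i) x e.
Proof. exact/diff_derivable/differentiable_coord. Qed.

Lemma derivable_monomial (R : realType) (d p : nat)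
    (a : {ffun 'I_d -> 'I_p.+1}) (W : normedModType R) (L : W -> 'rV[R]_d)
    (x e : W) :
  (forall i, derivable (fun y => L y ord0 i) x e) ->
  derivable (fun y => monomial a (L y)) x e.
Proof.
move=> dL; apply: (derivable_prod (F := fun i y => L y ord0 i ^+ a i)) => i.
by have := @derivableX _ _ _ (a i) _ _ (dL i); rewrite exprfctE.
Qed.

(** Near an interior point of [K] the function coincides with a polynomial in
    [y] or in [y *m A]. *)
Lemma derivable_in_local_space (R : realType) (d p : nat)
    (V : local_space R d) (K : set 'rV[R]_d) (v : 'rV[R]_d -> R)
    (x e : 'rV[R]_d) :
  in_local_space p V K v -> K° x -> derivable v x e.
Proof.
move=> + Kx.
have eqK w : (forall y, K y -> v y = w y) -> derivable w x e -> derivable v x e.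
  move=> vw; apply: near_eq_derivable.
  by near do (apply/esym/vw).
case: V => [|A _] /= [c vE]; apply: (eqK _ vE); apply: derivable_lincomb => a.
  by apply: (derivable_monomial (L := id)) => i; exact: derivable_coord.
apply: (derivable_monomial (L := mulmx^~ A)) => i.
rewrite (_ : (fun y => _) = fun y : 'rV[R]_d => \sum_j A j i * y ord0 j).
  by apply: derivable_lincomb => j; exact: derivable_coord.
by apply/funext => y; rewrite mxE; under eq_bigr do rewrite mulrC.
Unshelve. all: by end_near. Qed.

(** * The pointwise entropy identity *)

Lemma divergence_chain_in (R : realType) (d : nat) (A : set R)
    (g : R -> 'rV[R]_d) (v : 'rV[R]_d -> R) (x : 'rV[R]_d) :
  (\forall y \near x, A (v y)) -> (forall e, derivable v x e) ->
  derivable_in A g (v x) ->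
  divergence (g \o v) x =
  \sum_i 'D_(delta_mx ord0 i) v x * derive_in A g (v x) ord0 i.
Proof.
move=> vA dv dg; apply: eq_bigr => i _.
have dvi := is_derive_chain_in vA (dv (delta_mx ord0 i)) dg.
transitivity (('D_(delta_mx ord0 i) v x *: derive_in A g (v x)) ord0 i).
  rewrite -(derive_val (is_derive := dvi)) derive_mx; first by rewrite mxE.
  by case: dvi.
by rewrite mxE.
Qed.

(** If [v x] is isolated in [A], then [derive_in A square_entropy (v x)] is an
    arbitrary number; the identity persists since the chain rule computes the
    derivative of [square_entropy \o v] from any relative derivative of
    [square_entropy], in particular from [derive_in A square_entropy (v x)]
    and from [v x]. *)
Lemma derive_in_square_entropy_chain (R : realType) (W : normedModType R)
    (A : set R) (v : W -> R) (x e : W) :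
  (\forall y \near x, A (v y)) -> derivable v x e ->
  'D_e v x * derive_in A square_entropy (v x) = 'D_e v x * v x.
Proof.
move=> vA dv.
have eta_cvg := @square_entropy_cvg R A (v x).
have /cvgP eta_der := eta_cvg.
have [_ dA] := is_derive_chain_in vA dv eta_der.
have [_ dc] := is_derive_chain_in vA dv eta_cvg.
exact: etrans (esym dA) dc.
Qed.

(** The term [eta'(v)] from the definition of the entropy flux always comes
    multiplied by a derivative of [v], so it may be replaced by [v]. *)
Lemma divergence_entropy_flux (R : realType) (d : nat) (A : set R)
    (f q : R -> 'rV[R]_d) (v : 'rV[R]_d -> R) (x : 'rV[R]_d) :
  entropy_flux A f square_entropy q ->
  (forall c, A c -> derivable_in A f c) ->
  (\forall y \near x, A (v y)) -> (forall e, derivable v x e) ->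
  divergence (q \o v) x = v x * divergence (f \o v) x.
Proof.
move=> q_flux f_der vA dv.
have Ax : A (v x) := nbhs_singleton vA.
have [q_der q'E] := q_flux _ Ax.
rewrite (divergence_chain_in vA dv q_der).
rewrite (divergence_chain_in vA dv (f_der _ Ax)).
rewrite mulr_sumr; apply: eq_bigr => i _.
by rewrite q'E mxE mulrA derive_in_square_entropy_chain// mulrCA mulrA.
Qed.

Lemma dt_square_entropy (R : realType) (d : nat) (u : R -> 'rV[R]_d -> R)
    (t : R) (x : 'rV[R]_d) :
  0 <= t -> derivable_in [set s | 0 <= s] (u^~ x) t ->
  dt (fun s y => square_entropy (u s y)) t x = u t x * dt u t x.
Proof.
move=> t0 u_der; have FF := within_time_proper t0.
have tt : s @[s --> within [set s | 0 <= s] t^'] --> t.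
  exact: cvg_trans (cvg_within _) (cvg_within _).
have st : s - t @[s --> within [set s | 0 <= s] t^'] --> 0.
  by rewrite -[X in _ --> X](subrr t); apply: cvgB tt (cvg_cst t).
rewrite mulrC; apply: (cvg_lim (@norm_hausdorff _ _)).
apply: (@derivable_in_chain _ _ setT square_entropy (u t x) _ _ _ _
  (fun s => s - t) (u^~ x)) => //.
- rewrite near_withinE; near=> s => _; rewrite subr_eq0.
  by near: s; exact: nbhs_dnbhs_neq.
- exact: nearW.
- exact: square_entropy_cvg.
Unshelve. all: by end_near. Qed.

Unset Implicit Arguments.

(** * Entropy conservation *)

Theorem corollary1 (R : realType) (d : nat) (d_range : (1 <= d <= 3)%N)
    (M : periodic_mesh d) (p : nat) (V : 'I_(nelem M) -> local_space R d)
    (G : set R) (G_convex : @convex_set R R^o G)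
    (f : R -> 'rV[R]_d) (f_derivable : forall c, G c -> derivable_in G f c)
    (q : R -> 'rV[R]_d) (q_flux : entropy_flux G f square_entropy q)
    (u : R -> 'rV[R]_d -> R)
    (u_space : forall s, 0 <= s -> cg_space p V (u s))
    (u_range : forall s x, 0 <= s -> closure (domain M) x -> G (u s x))
    (t : R) (t_ge0 : 0 <= t)
    (u_derivable : forall x, closure (domain M) x ->
      derivable_in [set s | 0 <= s] (u^~ x) t)
    (u_scheme : cg_scheme p V f u t) :
  elementwise_integral M (fun x =>
    dt (fun s y => square_entropy (u s y)) t x + divergence (q \o u t) x) = 0%E.
Proof.
rewrite -[RHS](u_scheme (u t) (u_space t t_ge0)).
apply: eq_bigr => e _; apply: eq_integral => x; rewrite inE => xe.
have elem_sub : elem e `<=` closure (domain M).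
  by rewrite elem_cover; exact: bigcup_sup.
have u_near : \forall y \near x, G (u t y).
  by apply: filterS xe => y ye; apply: u_range => //; exact: elem_sub.
have [_ _ /(_ e) u_poly] := u_space t t_ge0.
congr (_%:E); rewrite mulrDr; congr (_ + _).
  apply: dt_square_entropy => //; apply/u_derivable/elem_sub.
  exact: interior_subset xe.
apply: (divergence_entropy_flux q_flux f_derivable u_near) => e'.
exact: derivable_in_local_space u_poly xe.
Qed.
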